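(* Let $n\geq 1$. There are infinitely many pairwise inequivalent $\mathbb{H}_{2n+1}$-structures on $\mathbb{P}V=\mathbb{P}^{2n+1}$ for which the central element $T$ fixes every point of the boundary and the induced $\mathbb{G}_a^{2n}$-structure on $\mathbb{P}\widetilde{V}$ is tautological. In particular, there are infinitely many pairwise inequivalent $\mathbb{H}_{2n+1}$-structures on $\mathbb{P}^{2n+1}$.
   Context: Work over $\mathbb{C}$. Let $\mathbb{W}$ be a $2n$-dimensional complex vector space with a non-degenerate skew-symmetric form $\omega$. The Heisenberg group $\mathbb{H}_{2n+1}$ is $\mathbb{W}\times\mathbb{C}$ with group law $(w_1,t_1)\cdot(w_2,t_2)=(w_1+w_2,\,t_1+t_2+\tfrac12\omega(w_1,w_2))$. Let $T=(0,1)$ and let $\mathbb{I}=\mathbb{C}T$ be its (one-dimensional) center; $\mathbb{H}_{2n+1}/\mathbb{I}\cong\mathbb{G}_a^{2n}$. Let $V\cong\mathbb{C}^{2n+2}$. An $\mathbb{H}_{2n+1}$-structure on $\mathbb{P}V$ is an effective algebraic action of $\mathbb{H}_{2n+1}$ on $\mathbb{P}V$ (generic stabilizer trivial) with a dense open orbit; the boundary (complement of the open orbit) is a hyperplane $\mathbb{P}V'$, $V'\subset V$ of dimension $2n+1$. Two actions $\alpha_i:G_i\times X_i\to X_i$ ($i=1,2$) are equivalent if there are a group isomorphism $\phi:G_1\to G_2$ and a variety isomorphism $\psi:X_1\to X_2$ with $\psi(\alpha_1(g,x))=\alpha_2(\phi(g),\psi(x))$ for all $g,x$. For a point $o$ of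 the open orbit, $\overline{\mathbb{I}\cdot o}$ is a projective line and $v$ denotes the point $\overline{\mathbb{I}\cdot o}\setminus\mathbb{I}\cdot o$; let $\hat v\in V$ represent $v$ and $\widetilde V=V/\mathbb{C}\hat v$. When $T$ fixes every point of $\mathbb{P}V'$, the action of $\mathbb{H}_{2n+1}$ descends (compatibly with the linear projection $\mathbb{P}V\dashrightarrow\mathbb{P}\widetilde V$) to an action of $\mathbb{H}_{2n+1}/\mathbb{I}\cong\mathbb{G}_a^{2n}$ on $\mathbb{P}\widetilde V\cong\mathbb{P}^{2n}$, called the induced $\mathbb{G}_a^{2n}$-structure. A $\mathbb{G}_a^{2n}$-structure on $\mathbb{P}^{2n}$ is tautological if (after identifying the group with $\mathbb{C}^{2n}$ and choosing homogeneous coordinates) it is $(a_1,\dots,a_{2n})\cdot[z_0,z_1,\dots,z_{2n}]=[z_0,z_1+a_1z_0,\dots,z_{2n}+a_{2n}z_0]$. *)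

(* Defs.v *)
From mathcomp Require Import all_boot all_algebra.
From mathcomp Require Import reals complex.
From mathcomp Require mpoly.

Set Implicit Arguments.
Unset Strict Implicit.
Unset Printing Implicit Defensive.
Import GRing.Theory.
Local Open Scope ring_scope.

Section Heisenberg.
Variable R : realType.
Local Notation C := R[i].
Variable n : nat.

Local Notation W := 'rV[C]_(2 * n).
Local Notation N := (2 * n).+2.
Local Notation V := 'cV[C]_N.

Definition nondeg_skew (Om : 'M[C]_(2 * n)) : Prop :=
  Om^T = - Om /\ Om \in unitmx.

Definition omega (Om : 'M[C]_(2 * n)) (w1 w2 : W) : C :=
  (w1 *m Om *m w2^T) 0 0.

Definition heis := (W * C)%type.

Definition heis_mul (Om : 'M[C]_(2 * n)) (g h : heis) : heis :=
  (g.1 + h.1, g.2 + h.2 + 2%:R^-1 * omega Om g.1 h.1).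

Definition heis_one : heis := (0, 0).

Definition heis_T : heis := (0, 1).

Definition heis_coord (g : heis) : 'I_(2 * n + 1) -> C :=
  fun i => (row_mx g.1 (g.2)%:M : 'rV[C]_(2 * n + 1)) 0 i.

(* A linear representation rho : H -> GL(V) which is algebraic
   (matrix entries are polynomial functions of the coordinates of H)
   and a group homomorphism. It induces an algebraic action of H on P(V). *)
Definition alg_rep (Om : 'M[C]_(2 * n)) (rho : heis -> 'M[C]_N) : Prop :=
  [/\ exists P : 'I_N -> 'I_N -> mpoly.mpoly (2 * n + 1) C,
        forall g i j, rho g i j = mpoly.meval (heis_coord g) (P i j),
      rho heis_one = 1%:M
    & forall g h, rho (heis_mul Om g h) = rho g *m rho h].

(* projective points of P(V) are represented by non-zero vectors;
   [x] = [y] iff x, y proportional *)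
Definition proj_eq (m : nat) (x y : 'cV[C]_m) : Prop :=
  exists c : C, c != 0 /\ x = c *: y.

(* subsets of P(V) are represented by predicates on V (only their values
   on non-zero vectors matter) *)
Definition homog (m d : nat) (p : mpoly.mpoly m C) : bool :=
  all (fun mm => mpoly.mdeg mm == d) (mpoly.msupp p).

Definition mev (m : nat) (p : mpoly.mpoly m C) (x : 'cV[C]_m) : C :=
  mpoly.meval (fun i => x i 0) p.

Definition zclosed (m : nat) (Z : 'cV[C]_m -> Prop) : Prop :=
  exists S : mpoly.mpoly m C -> Prop,
    (forall p, S p -> exists d, homog d p) /\
    (forall x, x != 0 -> (Z x <-> forall p, S p -> mev p x = 0)).

Definition zopen (m : nat) (O : 'cV[C]_m -> Prop) : Prop :=
  zclosed (fun x => ~ O x).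

Definition zdense (m : nat) (O : 'cV[C]_m -> Prop) : Prop :=
  forall Z, zclosed Z -> (forall x, x != 0 -> O x -> Z x) ->
    forall x, x != 0 -> Z x.

Definition zclosure (m : nat) (S : 'cV[C]_m -> Prop) : 'cV[C]_m -> Prop :=
  fun x => x != 0 /\ forall Z, zclosed Z ->
    (forall y, y != 0 -> S y -> Z y) -> Z x.

Definition orbit_in (rho : heis -> 'M[C]_N) (A : heis -> Prop) (o : V) :
  V -> Prop :=
  fun x => x != 0 /\ exists g, A g /\ proj_eq x (rho g *m o).

Definition orbit (rho : heis -> 'M[C]_N) (o : V) : V -> Prop :=
  orbit_in rho (fun _ => True) o.

Definition centre_I : heis -> Prop := fun g => g.1 = 0.

Definition trivial_stab (rho : heis -> 'M[C]_N) (o : V) : Prop :=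
  forall g, proj_eq (rho g *m o) o -> g = heis_one.

Definition open_orbit_point (rho : heis -> 'M[C]_N) (o : V) : Prop :=
  [/\ o != 0, zopen (orbit rho o), zdense (orbit rho o)
    & trivial_stab rho o].

Definition Hstructure (Om : 'M[C]_(2 * n)) (rho : heis -> 'M[C]_N) : Prop :=
  alg_rep Om rho /\ exists o, open_orbit_point rho o.

Definition T_fixes_boundary (rho : heis -> 'M[C]_N) (o : V) : Prop :=
  forall x, x != 0 -> ~ orbit rho o x -> proj_eq (rho heis_T *m x) x.

(* the tautological G_a^(2n)-action on P^(2n):
   (a_1..a_2n).[z_0, z_1, .., z_2n] = [z_0, z_1 + a_1 z_0, .., z_2n + a_2n z_0] *)
Definition taut_mx (a : W) : 'M[C]_((2 * n).+1) :=
  \matrix_(i, j) ((i == j)%:R +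
     (if (val j == 0)%N then (if unlift ord0 i is Some k then a 0 k else 0)
      else 0)).

(* The induced G_a^(2n) = H/I-structure on P(V/C hv) is tautological:
   there are an identification of the group C^(2n) with H/I = W
   (a |-> a *m A, A invertible) and homogeneous coordinates on V/C hv
   (a surjective linear map Pi : V -> C^(2n+1) with kernel C hv) in which
   the induced action is the tautological one. *)
Definition induced_tautological (rho : heis -> 'M[C]_N) (hv : V) : Prop :=
  exists (A : 'M[C]_(2 * n)) (Pi : 'M[C]_((2 * n).+1, N)),
    [/\ A \in unitmx, \rank Pi = (2 * n).+1, Pi *m hv = 0
      & forall (a : W) (t : C) (x : V), Pi *m x != 0 ->
          proj_eq (Pi *m (rho (a *m A, t) *m x)) (taut_mx a *m (Pi *m x))].

Definition boundary_of_I_orbit (rho : heis -> 'M[C]_N) (o' hv : V) : Prop :=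
  hv != 0 /\ zclosure (orbit_in rho centre_I o') hv /\
  ~ orbit_in rho centre_I o' hv.

Definition special_Hstructure (Om : 'M[C]_(2 * n)) (rho : heis -> 'M[C]_N)
  : Prop :=
  alg_rep Om rho /\
  exists o, [/\ open_orbit_point rho o, T_fixes_boundary rho o
    & forall o', orbit rho o o' ->
        (exists hv, boundary_of_I_orbit rho o' hv) /\
        (forall hv, boundary_of_I_orbit rho o' hv ->
           induced_tautological rho hv)].

(* automorphisms of the variety P^(N-1): morphisms given by homogeneous
   polynomials of a common degree without common non-trivial zero,
   with an inverse morphism of the same kind *)
Definition poly_map (d : nat) (F : 'I_N -> mpoly.mpoly N C) : Prop :=
  (forall i, homog d (F i)) /\
  (forall x : V, x != 0 -> exists i, mev (F i) x != 0).

Definition apply_map (F : 'I_N -> mpoly.mpoly N C) (x : V) : V :=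
  \col_i mev (F i) x.

Definition proj_automorphism (F : 'I_N -> mpoly.mpoly N C) : Prop :=
  exists dF dG (G : 'I_N -> mpoly.mpoly N C),
    [/\ poly_map dF F, poly_map dG G,
        forall x : V, x != 0 -> proj_eq (apply_map G (apply_map F x)) x
      & forall x : V, x != 0 -> proj_eq (apply_map F (apply_map G x)) x].

Definition heis_group_iso (Om : 'M[C]_(2 * n)) (phi : heis -> heis) : Prop :=
  bijective phi /\ forall g h, phi (heis_mul Om g h) = heis_mul Om (phi g) (phi h).

Definition equivalent (Om : 'M[C]_(2 * n)) (rho1 rho2 : heis -> 'M[C]_N)
  : Prop :=
  exists (phi : heis -> heis) (F : 'I_N -> mpoly.mpoly N C),
    [/\ heis_group_iso Om phi, proj_automorphism F
      & forall g (x : V), x != 0 ->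
          proj_eq (apply_map F (rho1 g *m x)) (rho2 (phi g) *m apply_map F x)].

End Heisenberg.

(* Main.v *)
Require Import Defs.
From mathcomp Require Import all_boot all_algebra.
From mathcomp Require Import reals complex ring.
From mathcomp Require mpoly.
Import (canonicals, coercions) mpoly.
Import GRing.Theory Num.Theory.
Local Open Scope ring_scope.

Set Implicit Arguments.
Unset Strict Implicit.
Unset Printing Implicit Defensive.

(* A symmetric form S on W gives the representation
     (w, t) |-> [[1, 0, 0], [S(w,w)/2 + t, 1, B(w, .)], [w^T, 0, 1]],
   B = S + omega/2, in coordinates (z_0, z_T, z_1, ..., z_2n); it is a
   homomorphism because the skew part of B is omega/2.  The open orbit is
   z_0 <> 0.  An equivalence is linear, since automorphisms of P^N are, and it
   intertwines the nilpotent parts rho(g) - 1, whose pairwise products are the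
   multiples B(w, w') E of one rank-one matrix E.  Hence it makes the two forms
   B congruent up to a scalar, so det S / det omega is an invariant; the choice
   S = k 1 gives infinitely many values. *)

(** * Polynomials in one variable and evaluation along curves *)

Lemma poly_nonvanishing_const (F : closedFieldType) (q : {poly F}) :
  (forall t, q.[t] != 0) -> exists2 c, c != 0 & forall t, q.[t] = c.
Proof.
move=> q0; have /size_poly1P[c c0 ->] : size q == 1%N.
  by apply/negPn/negP => /closed_rootP[t /rootP/eqP]; rewrite (negPf (q0 t)).
by exists c => // t; rewrite hornerC.
Qed.

(** In characteristic zero [a + 1], [a + 2], ... are distinct, differ from [a], and outnumber the
    roots that a nonzero [q] can have. *)
Lemma poly_eq0_away (F : numDomainType) (q : {poly F}) (a : F) :
  (forall t, t != a -> q.[t] = 0) -> q = 0.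
Proof.
move=> q0; apply/eqP/negPn/negP => qn0.
have := @max_poly_roots _ q [seq a + i.+1%:R | i <- iota 0 (size q)] qn0.
rewrite size_map size_iota ltnn => H; suff: false by []; apply: H.
  apply/allP => _ /mapP[i _ ->]; apply/rootP/q0.
  by rewrite -subr_eq0 addrAC subrr add0r pnatr_eq0.
by rewrite map_inj_uniq ?iota_uniq // => i j /addrI/eqP; rewrite eqr_nat => /eqP[].
Qed.

(** Substituting polynomials for the variables restricts [p] to a parametrised curve. *)
Lemma horner_mmap (F : comNzRingType) (m : nat) (p : mpoly.mpoly m F)
    (f : 'I_m -> {poly F}) (t : F) :
  (mpoly.mmap polyC f p).[t] = mpoly.meval (fun i => (f i).[t]) p.
Proof.
rewrite /mpoly.mmap mpoly.mevalE horner_sum; apply: eq_bigr => k _.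
rewrite hornerM hornerC /mpoly.mmap1 horner_prod.
by congr (_ * _); apply: eq_bigr => i _; rewrite horner_exp.
Qed.

Lemma eq_meval (F : nzRingType) (m : nat) (p : mpoly.mpoly m F) (u v : 'I_m -> F) :
  u =1 v -> mpoly.meval u p = mpoly.meval v p.
Proof.
move=> uv; rewrite !mpoly.mevalE; apply: eq_bigr => k _; congr (_ * _).
by apply: eq_bigr => i _; rewrite uv.
Qed.

(** * Restriction to lines, and linear maps of projective space *)

Section ProjectiveSpace.
Variable R : realType.
Local Notation C := R[i].

Lemma mev_line (m : nat) (p : mpoly.mpoly m C) (x y : 'cV[C]_m) :
  exists q : {poly C}, forall t, q.[t] = mev p (x + t *: y).
Proof.
exists (mpoly.mmap polyC (fun i => (x i 0)%:P + (y i 0) *: 'X) p) => t.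
by rewrite horner_mmap; apply: eq_meval => i; rewrite !hornerE !mxE mulrC.
Qed.

Lemma mevZ (m d : nat) (p : mpoly.mpoly m C) (c : C) (x : 'cV[C]_m) :
  homog d p -> mev p (c *: x) = c ^+ d * mev p x.
Proof.
rewrite /homog => /allP hp; rewrite /mev !mpoly.mevalE mulr_sumr !big_seq.
apply: eq_bigr => k /hp/eqP <-; rewrite mulrCA; congr (_ * _).
rewrite mpoly.mdegE -prodrXr -big_split /=.
by apply: eq_bigr => i _; rewrite !mxE exprMn.
Qed.

Lemma mev_homog1 (m : nat) (p : mpoly.mpoly m C) (x : 'cV[C]_m) :
  homog 1 p -> mev p x = \sum_j mpoly.mcoeff (mpoly.mnm1 j) p * x j 0.
Proof.
rewrite /homog => /allP hp.
have -> : p = \sum_j mpoly.mcoeff (mpoly.mnm1 j) p *: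
    @mpoly.mpolyX m C (mpoly.mnm1 j).
  apply/mpoly.mpolyP => k; rewrite raddf_sum /=.
  have E j : mpoly.mcoeff k (mpoly.mcoeff (mpoly.mnm1 j) p *:
        @mpoly.mpolyX m C (mpoly.mnm1 j))
     = mpoly.mcoeff k p * (mpoly.mnm1 j == k)%:R.
    rewrite mpoly.mcoeffZ mpoly.mcoeffX.
    by case: eqP => [->|]; rewrite ?mulr1 // !mulr0.
  rewrite (eq_bigr _ (fun j _ => E j)) -mulr_sumr.
  have [/mpoly.mdeg1P[i /eqP ->]|k1] := boolP (mpoly.mdeg k == 1%N).
    rewrite (bigD1 i) //= eqxx big1 ?addr0 ?mulr1 // => j /negPf ji.
    case: eqP => // /(congr1 (fun u : mpoly.multinom m => u j)).
    by rewrite !mpoly.mnm1E eqxx eq_sym ji.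
  rewrite (@mpoly.memN_msupp_eq0 _ _ p k) ?mul0r //.
  by apply: contra k1 => /hp.
rewrite /mev raddf_sum; apply: eq_bigr => j _ /=.
rewrite mpoly.mevalZ mpoly.mevalXU; congr (_ * _).
rewrite raddf_sum (bigD1 j) //= mpoly.mcoeffZ mpoly.mcoeffX eqxx mulr1.
rewrite big1 ?addr0 // => i /negPf ij.
rewrite mpoly.mcoeffZ mpoly.mcoeffX; case: eqP; rewrite ?mulr0 //.
move=> /(congr1 (fun u : mpoly.multinom m => u i)).
by rewrite !mpoly.mnm1E eqxx eq_sym ij.
Qed.

(** Eigenvectors [e_j] make [A] diagonal; the eigenvectors [e_j + e_0] make all diagonal entries
    equal. *)
Lemma scalar_of_eigenvectors (m : nat) (A : 'M[C]_m.+1) :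
  (forall x : 'cV_m.+1, x != 0 -> exists c, A *m x = c *: x) ->
  exists c, A = c%:M.
Proof.
move=> H.
have d0 (i : 'I_m.+1) : delta_mx i 0 != 0 :> 'cV[C]_m.+1.
  by apply/eqP => /matrixP/(_ i 0); rewrite !mxE !eqxx => /eqP; rewrite oner_eq0.
have col j : exists c, forall i, A i j = c * (i == j)%:R.
  have [c Ec] := H _ (d0 j); exists c => i.
  by have /matrixP/(_ i 0) := Ec; rewrite -colE !mxE eqxx andbT.
exists (A 0 0); apply/matrixP => i j; rewrite !mxE -mulr_natr.
have [c Ec] := col j; rewrite Ec; case: eqP => [_|_]; last by rewrite !mulr0.
rewrite !mulr1; case: (eqVneq j 0) Ec => [-> ->|j0 Ec]; first by rewrite eqxx mulr1.
have [c0 Ec0] := col 0.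
have x0 : delta_mx j 0 + delta_mx 0 0 != 0 :> 'cV[C]_m.+1.
  apply/eqP => /matrixP/(_ j 0); rewrite !mxE !eqxx (negPf j0) addr0.
  by move=> /eqP; rewrite oner_eq0.
have [k /matrixP Ek] := H _ x0.
have := Ek j 0; have := Ek 0 0; rewrite mulmxDr -!colE !mxE !eqxx.
rewrite !Ec !Ec0 !eqxx (negPf j0) eq_sym (negPf j0) /=.
by rewrite !(mulr0, mulr1, addr0, add0r) => -> ->.
Qed.

(** * Automorphisms of projective space are linear *)

Section Automorphisms.
Variable n : nat.
Local Notation N := (2 * n).+2.
Local Notation V := 'cV[C]_N.
Implicit Types (F G : 'I_N -> mpoly.mpoly N C) (x : V).

Lemma apply_mapE F x i : apply_map F x i 0 = mev (F i) x.
Proof. by rewrite mxE. Qed.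

Lemma apply_mapZ d F c x : poly_map d F ->
  apply_map F (c *: x) = c ^+ d *: apply_map F x.
Proof. by case=> hF _; apply/colP => i; rewrite !mxE (mevZ _ _ (hF i)). Qed.

Lemma apply_map_neq0 d F x : poly_map d F -> x != 0 -> apply_map F x != 0.
Proof.
case=> _ hF x0; have [k] := hF x x0; apply: contra => /eqP E.
by rewrite -apply_mapE E mxE.
Qed.

Lemma comp_poly_line F G i (x y : V) :
  exists q : {poly C}, forall t, q.[t] = mev (G i) (apply_map F (x + t *: y)).
Proof.
have /fin_all_exists[f Ef] j := mev_line (F j) x y.
exists (mpoly.mmap polyC f (G i)) => t.
by rewrite horner_mmap; apply: eq_meval => j; rewrite Ef mxE.
Qed.

Lemma basis_line_neq0 (i j : 'I_N) t : i != j ->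
  delta_mx i 0 + t *: delta_mx j 0 != 0 :> V.
Proof.
move=> ij; apply/eqP => /colP/(_ i).
by rewrite !mxE eqxx (negPf ij) mulr0 addr0 => /eqP; rewrite oner_eq0.
Qed.

(* Along the line the ratio of G (F x) to x is a polynomial without zeros. *)
Lemma comp_on_line dF dG F G (i j : 'I_N) :
  poly_map dF F -> poly_map dG G ->
  (forall x, x != 0 -> proj_eq (apply_map G (apply_map F x)) x) -> i != j ->
  exists2 c, c != 0 & forall t,
    apply_map G (apply_map F (delta_mx i 0 + t *: delta_mx j 0))
    = c *: (delta_mx i 0 + t *: delta_mx j 0).
Proof.
move=> hF hG GF ij.
have [q Eq] := comp_poly_line F G i (delta_mx i 0) (delta_mx j 0).
have key t : q.[t] != 0 /\
    apply_map G (apply_map F (delta_mx i 0 + t *: delta_mx j 0))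
    = q.[t] *: (delta_mx i 0 + t *: delta_mx j 0).
  have [k [k0 Ek]] := GF _ (basis_line_neq0 t ij).
  (* The coordinate of index [i] is 1 along the line, so the ratio [k] is that coordinate of the
     image, a polynomial in [t]. *)
  have -> : q.[t] = k.
    rewrite Eq -apply_mapE Ek !mxE eqxx (negPf ij).
    by rewrite mulr0 addr0 mulr1.
  by [].
have [c c0 Ec] := poly_nonvanishing_const (fun t => (key t).1).
by exists c => // t; have [_] := key t; rewrite Ec.
Qed.

(* With D = dF dG, evaluating G o F at 2 e_0 + e_1 on the two lines through
   e_0 and e_1 gives 2^D = 2. *)
Lemma aut_degree dF dG F G :
  poly_map dF F -> poly_map dG G ->
  (forall x, x != 0 -> proj_eq (apply_map G (apply_map F x)) x) ->
  (dF * dG = 1)%N.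
Proof.
move=> hF hG GF.
have GFZ a x : apply_map G (apply_map F (a *: x))
    = a ^+ (dF * dG) *: apply_map G (apply_map F x).
  by rewrite (apply_mapZ _ _ hF) (apply_mapZ _ _ hG) exprM.
have [c c0 Ec] := comp_on_line hF hG GF (isT : (0 : 'I_N) != 1).
have [d d0 Ed] := comp_on_line hF hG GF (isT : (1 : 'I_N) != 0).
(* The two lines share the point [e_0 + e_1], reached at [t = 1] on both. *)
have cd : c = d.
  have /colP/(_ 0) := Ed 1; rewrite scale1r addrC -{1}[delta_mx 1 0]scale1r Ec.
  by rewrite scale1r !mxE !eqxx /= !addr0 !mulr1.
have two0 : 2%:R != 0 :> C by rewrite pnatr_eq0.
have /colP/(_ 0) := Ed 2%:R.
have -> : delta_mx 1 0 + 2%:R *: delta_mx 0 0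
    = 2%:R *: (delta_mx 0 0 + 2%:R^-1 *: delta_mx 1 0) :> V.
  by rewrite scalerDr scalerA divff // scale1r addrC.
rewrite GFZ Ec -cd !mxE !eqxx /= !(mulr0, addr0, mulr1).
rewrite mulrC => /(mulfI c0)/eqP; rewrite -natrX eqr_nat.
by rewrite -{2}[2%N]expn1 eqn_exp2l // => /eqP.
Qed.

(** Degree one makes [F] a matrix, and a kernel vector would be a common zero of its components. *)
Lemma proj_automorphism_linear F : proj_automorphism F ->
  exists2 M : 'M[C]_N, M \in unitmx & forall x, apply_map F x = M *m x.
Proof.
case=> dF [dG [G [hF hG GF _]]].
have /eqP := aut_degree hF hG GF; rewrite muln_eq1 => /andP[/eqP d1 _].
rewrite {}d1 in hF *.
pose M : 'M[C]_N := \matrix_(i, j) mpoly.mcoeff (mpoly.mnm1 j) (F i).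
have EM x : apply_map F x = M *m x.
  apply/colP => i; rewrite !mxE (mev_homog1 _ (hF.1 i)).
  by apply: eq_bigr => j _; rewrite mxE.
exists M => //; rewrite -unitmx_tr unitmxE unitfE.
apply/negP => /det0P[v v0 /(congr1 trmx)]; rewrite trmx_mul trmxK trmx0 => Mv.
have vT0 : v^T != 0 by rewrite -trmx0 (inj_eq trmx_inj).
by have := apply_map_neq0 hF vT0; rewrite EM Mv eqxx.
Qed.

End Automorphisms.

(** [B^-1 A] preserves every line through 0, hence is scalar. *)
Lemma proj_eq_mx_scalar (m : nat) (A B : 'M[C]_m.+1) : B \in unitmx ->
  (forall x : 'cV_m.+1, x != 0 -> proj_eq (A *m x) (B *m x)) ->
  exists c, A = c *: B.
Proof.
move=> uB H.
have [x x0|c Ec] := @scalar_of_eigenvectors _ (invmx B *m A).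
  have [c [_ Ec]] := H x x0; exists c.
  by rewrite -mulmxA Ec -scalemxAr mulKmx.
by exists c; rewrite -[A](mulKVmx uB) Ec -mul_mx_scalar.
Qed.

End ProjectiveSpace.

(** * Nilpotent parts of the representation and their products *)

Section NilpotentPart.
Variables (F : comNzRingType) (m : nat).
Implicit Types (B : 'M[F]_m) (w : 'rV[F]_m) (s : F).

(* Coordinates are ordered as (z_0, z_T, z_1, ..., z_m), where z_T is the
   coordinate along the fixed vector of the group, so that the block sizes
   add up definitionally. *)
Definition nil_mx B w s : 'M[F]_(1 + (1 + m)) :=
  block_mx 0 0 (col_mx s%:M w^T)
           (block_mx 0 (w *m B) 0 0).

(** The nilpotent part of [T], the same for every form. *)
Definition central_mx : 'M[F]_(1 + (1 + m)) := nil_mx 0 0 1.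

Definition bilin B w1 w2 : F := (w1 *m B *m w2^T) 0 0.

(** [z_T] is annihilated, so the only surviving path runs from [z_0] through [w2^T] to [z_T]; the
    entries [s1] and [s2] drop out. *)
Lemma nil_mxM B w1 s1 w2 s2 :
  nil_mx B w1 s1 *m nil_mx B w2 s2 = bilin B w1 w2 *: central_mx.
Proof.
rewrite /nil_mx /central_mx mulmx_block /nil_mx.
rewrite !(mul0mx, mulmx0, addr0, add0r) mulmx_block.
rewrite mul_block_col !(mul0mx, mulmx0, addr0, add0r).
rewrite [w1 *m B *m w2^T]mx11_scalar -/(bilin _ _ _).
rewrite scale_block_mx scale_col_mx !scaler0 trmx0 scaler0.
by rewrite scale_scalar_mx mulr1 !block_mx0 scaler0.
Qed.

Lemma nil_mxD B w1 s1 w2 s2 :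
  nil_mx B w1 s1 + nil_mx B w2 s2 = nil_mx B (w1 + w2) (s1 + s2).
Proof.
rewrite /nil_mx add_block_mx !addr0 add_col_mx.
rewrite add_block_mx !addr0 -mulmxDl.
by rewrite linearD raddfD.
Qed.

Lemma nil_mx_central B s : nil_mx B 0 s = s *: central_mx.
Proof.
rewrite /central_mx /nil_mx scale_block_mx scale_col_mx.
by rewrite !mul0mx !block_mx0 !scaler0 trmx0 scaler0 scale_scalar_mx mulr1.
Qed.

Lemma mxtrace_nil_mx B w s : \tr (nil_mx B w s) = 0.
Proof.
by rewrite /nil_mx mxtrace_block mxtrace_block !mxtrace0 !addr0.
Qed.

Lemma det_unipotent B w s : \det (1%:M + nil_mx B w s) = 1.
Proof.
rewrite /nil_mx scalar_mx_block add_block_mx !add0r !addr0 det_lblock.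
by rewrite scalar_mx_block add_block_mx !add0r !addr0 det_ublock !det1 !mulr1.
Qed.

Lemma nil_mx_mul_col B w s (x0 x1 : 'M[F]_1) (x : 'cV[F]_m) :
  nil_mx B w s *m (col_mx x0 (col_mx x1 x) : 'cV[F]_(1 + (1 + m)))
  = col_mx 0 (col_mx (s *: x0 + w *m B *m x) (w^T *m x0)).
Proof.
rewrite /nil_mx mul_block_col !(mul0mx, add0r) mul_col_mx.
rewrite mul_block_col !(mul0mx, add0r, addr0) mul_scalar_mx.
by rewrite add_col_mx addr0.
Qed.

Lemma central_mx_neq0 : central_mx != 0.
Proof.
apply/eqP => /matrixP/(_ (rshift 1 (lshift m 0)) (lshift (1 + m) 0)).
by rewrite /central_mx block_mxEdl col_mxEu !mxE eqxx => /eqP; rewrite oner_eq0.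
Qed.

End NilpotentPart.

(** * The representation attached to a symmetric form *)

Section Representation.
Variables (R : realType) (n : nat) (Om : 'M[R[i]]_(2 * n)).
Local Notation C := R[i].
Local Notation N := (2 * n).+2.
Local Notation heis := (heis R n).
Implicit Types (S : 'M[C]_(2 * n)) (g h : heis).

Lemma bilinD S T w1 w2 : bilin (S + T) w1 w2 = bilin S w1 w2 + bilin T w1 w2.
Proof. by rewrite /bilin mulmxDr mulmxDl mxE. Qed.

Lemma bilinDl S w1 w2 w : bilin S (w1 + w2) w = bilin S w1 w + bilin S w2 w.
Proof. by rewrite /bilin !mulmxDl mxE. Qed.

Lemma bilinDr S w w1 w2 : bilin S w (w1 + w2) = bilin S w w1 + bilin S w w2.
Proof. by rewrite /bilin linearD mulmxDr mxE. Qed.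

Lemma bilinZ a S w1 w2 : bilin (a *: S) w1 w2 = a * bilin S w1 w2.
Proof. by rewrite /bilin -scalemxAr -scalemxAl mxE. Qed.

Lemma bilin_sym S w1 w2 : S^T = S -> bilin S w1 w2 = bilin S w2 w1.
Proof.
move=> sS; rewrite /bilin.
have -> : w1 *m S *m w2^T = (w2 *m S *m w1^T)^T.
  by rewrite !trmx_mul trmxK sS mulmxA.
by rewrite [LHS]mxE.
Qed.

(* The group law forces the skew part omega/2; the symmetric part S is free. *)
Definition heis_form S := S + 2%:R^-1 *: Om.

Definition heis_rep S g : 'M[C]_N :=
  1%:M + nil_mx (heis_form S) g.1 (2%:R^-1 * bilin S g.1 g.1 + g.2).

Lemma heis_rep1 S : heis_rep S (heis_one R n) = 1%:M.
Proof.
by rewrite /heis_rep /= nil_mx_central /bilin !mul0mx mxE mulr0 addr0 scale0r addr0.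
Qed.

Lemma heis_repM S g h : S^T = S ->
  heis_rep S (heis_mul Om g h) = heis_rep S g *m heis_rep S h.
Proof.
move=> sS; rewrite /heis_rep mulmxDl mul1mx mulmxDr mulmx1 -addrA nil_mxM.
rewrite -(nil_mx_central (heis_form S)) !nil_mxD addr0 /= [h.1 + _]addrC.
congr (_ + nil_mx _ _ _).
(* The central entry of the product gains [B(g, h)]: its skew part is the group cocycle, its
   symmetric part the cross term of [S(g + h, g + h) / 2]. *)
rewrite /heis_form bilinD bilinZ /omega -/(bilin Om _ _).
have -> : bilin S (g.1 + h.1) (g.1 + h.1)
    = bilin S g.1 g.1 + bilin S h.1 h.1 + 2%:R * bilin S g.1 h.1.
  rewrite bilinDl !bilinDr.
  by rewrite (bilin_sym h.1 g.1 sS); ring.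
by field.
Qed.

(** * Algebraicity: polynomial functions on the Heisenberg group *)

Definition polyfun (f : heis -> C) :=
  exists P, forall g, f g = mpoly.meval (heis_coord g) P.

Definition polymx p q (A : heis -> 'M[C]_(p, q)) :=
  forall i j, polyfun (fun g => A g i j).

Lemma polyfun_ext f1 f2 : f1 =1 f2 -> polyfun f1 -> polyfun f2.
Proof. by move=> E [P EP]; exists P => g; rewrite -E. Qed.

Lemma polyfun_cst c : polyfun (fun=> c).
Proof. by exists (mpoly.mpolyC _ c) => g; rewrite mpoly.mevalC. Qed.

Lemma polyfunD f1 f2 : polyfun f1 -> polyfun f2 -> polyfun (fun g => f1 g + f2 g).
Proof. by case=> P EP [Q EQ]; exists (P + Q) => g; rewrite mpoly.mevalD EP EQ. Qed.

Lemma polyfunM f1 f2 : polyfun f1 -> polyfun f2 -> polyfun (fun g => f1 g * f2 g).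
Proof. by case=> P EP [Q EQ]; exists (P * Q) => g; rewrite mpoly.mevalM EP EQ. Qed.

Lemma polyfun_sum (I : finType) (f : I -> heis -> C) :
  (forall i, polyfun (f i)) -> polyfun (fun g => \sum_i f i g).
Proof.
move=> /fin_all_exists[P EP]; exists (\sum_i P i) => g.
by rewrite raddf_sum; apply: eq_bigr.
Qed.

Lemma polymx_fst : polymx (fun g => g.1).
Proof.
move=> i j; exists (@mpoly.mpolyX _ C (mpoly.mnm1 (lshift 1 j))) => g.
by rewrite mpoly.mevalXU /heis_coord row_mxEl ord1.
Qed.

Lemma polyfun_snd : polyfun snd.
Proof.
exists (@mpoly.mpolyX _ C (mpoly.mnm1 (rshift (2 * n) 0))) => g.
by rewrite mpoly.mevalXU /heis_coord row_mxEr mxE eqxx mulr1n.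
Qed.

Lemma polymx_cst p q (A : 'M[C]_(p, q)) : polymx (fun=> A).
Proof. by move=> i j; apply: polyfun_cst. Qed.

Lemma polymxD p q (A B : heis -> 'M[C]_(p, q)) :
  polymx A -> polymx B -> polymx (fun g => A g + B g).
Proof.
move=> hA hB i j; apply: polyfun_ext (polyfunD (hA i j) (hB i j)) => g.
by rewrite mxE.
Qed.

Lemma polymxM p q r (A : heis -> 'M[C]_(p, q)) (B : heis -> 'M[C]_(q, r)) :
  polymx A -> polymx B -> polymx (fun g => A g *m B g).
Proof.
move=> hA hB i j.
have := polyfun_sum (fun k => polyfunM (hA i k) (hB k j)).
by apply: polyfun_ext => g; rewrite mxE.
Qed.

Lemma polymx_tr p q (A : heis -> 'M[C]_(p, q)) :
  polymx A -> polymx (fun g => (A g)^T).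
Proof. by move=> hA i j; apply: polyfun_ext (hA j i) => g; rewrite mxE. Qed.

Lemma polymx_scalar f : polyfun f -> polymx (fun g => (f g)%:M : 'M_1).
Proof.
by move=> hf i j; apply: polyfun_ext hf => g; rewrite !ord1 mxE eqxx mulr1n.
Qed.

Lemma polymx_col p q r (A : heis -> 'M[C]_(p, r)) (B : heis -> 'M[C]_(q, r)) :
  polymx A -> polymx B -> polymx (fun g => col_mx (A g) (B g)).
Proof.
move=> hA hB i j; rewrite -(splitK i); case: (split i) => k /=.
  by apply: polyfun_ext (hA k j) => g; rewrite col_mxEu.
by apply: polyfun_ext (hB k j) => g; rewrite col_mxEd.
Qed.

Lemma polymx_row p q r (A : heis -> 'M[C]_(p, q)) (B : heis -> 'M[C]_(p, r)) :
  polymx A -> polymx B -> polymx (fun g => row_mx (A g) (B g)).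
Proof.
move=> hA hB i j; rewrite -(splitK j); case: (split j) => k /=.
  by apply: polyfun_ext (hA i k) => g; rewrite row_mxEl.
by apply: polyfun_ext (hB i k) => g; rewrite row_mxEr.
Qed.

Lemma heis_rep_poly S : polymx (heis_rep S).
Proof.
have hform : polymx (fun g : heis => g.1 *m heis_form S).
  exact: polymxM polymx_fst (polymx_cst _).
have hq : polyfun (fun g : heis => 2%:R^-1 * bilin S g.1 g.1 + g.2).
  apply: polyfunD polyfun_snd; apply: polyfunM; first exact: polyfun_cst.
  apply: (polymxM (polymxM polymx_fst (polymx_cst S)) (polymx_tr polymx_fst)).
apply: polymxD; first exact: polymx_cst.
apply: (@polymx_col 1 (1 + 2 * n) (1 + (1 + 2 * n))); apply: polymx_row.
- exact: polymx_cst.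
- exact: polymx_cst.
- exact: polymx_col (polymx_scalar hq) (polymx_tr polymx_fst).
apply: polymx_col; apply: polymx_row; try exact: polymx_cst.
exact: hform.
Qed.

Lemma heis_rep_alg S : S^T = S -> alg_rep Om (heis_rep S).
Proof.
move=> sS; split; [|exact: heis_rep1|by move=> g h; exact: heis_repM].
(* Finite choice collects the polynomials, first along each row, then over all rows. *)
have /fin_all_exists[P EP] k : exists P : 'I_N -> mpoly.mpoly (2 * n + 1) C,
    forall j g, heis_rep S g k j = mpoly.meval (heis_coord g) (P j).
  by have /fin_all_exists[P EP] := heis_rep_poly S k; exists P.
by exists P => g k j; apply: EP.
Qed.

End Representation.

(** * Geometry of the action: open orbit, boundary and induced structure *)

Section SpecialStructure.
Variables (R : realType) (n : nat) (Om : 'M[R[i]]_(2 * n)).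
Local Notation C := R[i].
Local Notation N := (2 * n).+2.
Local Notation V := 'cV[C]_N.
Local Notation heis := (heis R n).
Implicit Types (S : 'M[C]_(2 * n)) (g h : heis) (a b c : C) (y : 'cV[C]_(2 * n)).

(** Homogeneous coordinates: [a] is [z_0], [b] is [z_T], and [y] collects [z_1], ..., [z_2n]. *)
Definition vec a b y : 'cV[C]_(1 + (1 + 2 * n)) :=
  col_mx (a%:M : 'M_1) (col_mx (b%:M : 'M_1) y).

Lemma vec_surj (x : V) : exists a b y, x = vec a b y.
Proof.
pose x' : 'cV[C]_(1 + (1 + 2 * n)) := x.
exists (usubmx x' 0 0), (usubmx (dsubmx x') 0 0), (dsubmx (dsubmx x')).
by rewrite /vec -!mx11_scalar !vsubmxK.
Qed.

Lemma vecE0 a b y : vec a b y 0 0 = a.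
Proof.
have -> : 0 = lshift (1 + 2 * n) (0 : 'I_1) :> 'I_N by apply: val_inj.
by rewrite /vec (@col_mxEu _ 1) mxE eqxx mulr1n.
Qed.

Lemma vecE2 a b y k : vec a b y (rshift 1 (rshift 1 k)) 0 = y k 0.
Proof. by rewrite /vec (@col_mxEd _ 1) (@col_mxEd _ 1). Qed.

Lemma vecZ c a b y : c *: vec a b y = vec (c * a) (c * b) (c *: y).
Proof. by rewrite /vec !scale_col_mx !scale_scalar_mx. Qed.

Lemma vecD a b y a' b' y' : vec a b y + vec a' b' y' = vec (a + a') (b + b') (y + y').
Proof. by rewrite /vec !add_col_mx !raddfD. Qed.

Lemma vec_inj a b y a' b' y' :
  vec a b y = vec a' b' y' -> [/\ a = a', b = b' & y = y'].
Proof.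
move=> /eq_col_mx[/matrixP/(_ 0 0) Ea /eq_col_mx[/matrixP/(_ 0 0) Eb ->]].
by move: Ea Eb; rewrite !mxE eqxx !mulr1n => -> ->.
Qed.

Lemma vec0 : vec 0 0 0 = 0.
Proof. by rewrite /vec !raddf0 !col_mx0. Qed.

Lemma heis_rep_vec S g a b y :
  heis_rep Om S g *m vec a b y =
  vec a (b + ((2%:R^-1 * bilin S g.1 g.1 + g.2) * a + (g.1 *m heis_form Om S *m y) 0 0))
      (y + a *: g.1^T).
Proof.
rewrite /heis_rep mulmxDl mul1mx nil_mx_mul_col.
rewrite [g.1 *m _ *m y]mx11_scalar scale_scalar_mx -raddfD.
rewrite mul_mx_scalar -(raddf0 (@scalar_mx _ 1)) -/(vec _ _ _) vecD addr0.
by rewrite [in RHS]mxE eqxx mulr1n.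
Qed.

Definition origin : V := vec 1 0 0.
(** Represents the point [v], the limit of every central orbit in the open orbit. *)
Definition vT : V := vec 0 1 0.

Lemma vec_neq0 a b y : a != 0 -> vec a b y != 0.
Proof.
move=> a0; apply: contra a0 => /eqP/(congr1 (fun x : V => x 0 0)).
by rewrite vecE0 mxE => ->.
Qed.

Lemma vT_neq0 : vT != 0.
Proof. by rewrite -vec0; apply/eqP => /vec_inj[_ /eqP]; rewrite oner_eq0. Qed.

Lemma heis_rep_origin S g :
  heis_rep Om S g *m origin = vec 1 (2%:R^-1 * bilin S g.1 g.1 + g.2) g.1^T.
Proof. by rewrite heis_rep_vec mulmx0 mxE addr0 !add0r mulr1 scale1r. Qed.

(** Central elements act as transvections, trivial on the hyperplane [z_0 = 0]. *)
Lemma heis_rep_centre S g (x : V) : centre_I g ->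
  heis_rep Om S g *m x = x + (g.2 * x 0 0) *: vT.
Proof.
rewrite /centre_I => g1; have [a [b [y ->]]] := vec_surj x.
rewrite vecE0 heis_rep_vec g1 /bilin !mul0mx mxE mulr0 add0r addr0 trmx0 scaler0.
by rewrite vecZ vecD !mulr0 mulr1 scaler0 !addr0.
Qed.

(** The group preserves [z_0]; conversely, once [z_0] is normalised to 1, [w] is read off [y] and
    then [t] off [z_T]. *)
Lemma orbit_originE S (x : V) : Defs.orbit (heis_rep Om S) origin x <-> x 0 0 != 0.
Proof.
split=> [[x0 [g [_ [c [c0 ->]]]]]|].
  by rewrite heis_rep_origin vecZ vecE0 mulr1.
have [a [b [y ->]]] := vec_surj x; rewrite vecE0 => a0.
split; first exact: vec_neq0.
pose w := a^-1 *: y^T; exists (w, a^-1 * b - 2%:R^-1 * bilin S w w); split=> //.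
exists a; split=> //; rewrite heis_rep_origin /= addrC subrK vecZ mulr1 mulVKf //.
by rewrite /w linearZ /= trmxK scalerA divff // scale1r.
Qed.

(** The two predicates are convertible, which makes the closure properties of homogeneous
    polynomials available for [homog]. *)
Lemma homogE m d (p : mpoly.mpoly m C) :
  homog d p = (p \is @mpoly.ishomog1 m C d (@mpoly.mdeg m)).
Proof. by []. Qed.

Lemma homog1X m (i : 'I_m) :
  @mpoly.mpolyX m C (mpoly.mnm1 i) \is @mpoly.ishomog1 m C 1 (@mpoly.mdeg m).
Proof. by rewrite mpoly.dhomogX /= mpoly.mdeg1. Qed.

Lemma mevX m (i : 'I_m) (x : 'cV[C]_m) :
  mev (@mpoly.mpolyX m C (mpoly.mnm1 i)) x = x i 0.
Proof. by rewrite /mev mpoly.mevalXU. Qed.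

(** Each defining polynomial restricts to a polynomial in [t] with infinitely many zeros, so it
    vanishes at [t = 0] too, even when [a = 0]. This serves both for density and for limit
    points. *)
Lemma zclosed_line m (Z : 'cV[C]_m -> Prop) (x y : 'cV[C]_m) :
  zclosed Z -> x != 0 -> forall a,
  (forall t, t != a -> x + t *: y != 0 /\ Z (x + t *: y)) -> Z x.
Proof.
move=> [P [_ HP]] x0 a Zline; apply/HP => // p Pp.
have [q Eq] := mev_line p x y.
have q0 : q = 0.
  apply: (@poly_eq0_away _ q a) => t /Zline[l0 Zl].
  by rewrite Eq; apply: (HP _ l0).1 Pp.
by have := Eq 0; rewrite q0 horner0 scale0r addr0.
Qed.

Lemma open_orbit_origin S : open_orbit_point (heis_rep Om S) origin.
Proof.
split.
- exact/vec_neq0/oner_neq0.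
(* The complement of the orbit is cut out by the single form [z_0]. *)
- exists (eq (@mpoly.mpolyX N C (mpoly.mnm1 0))); split=> [p <-|x x0].
    by exists 1%N; rewrite homogE homog1X.
  split=> [no p <-|H].
    by rewrite mevX; apply/eqP/negPn/negP => /orbit_originE.
  by move/orbit_originE/negP; apply; rewrite -mevX; apply/eqP/H.
(* The line through [x] in direction [origin] meets [z_0 = 0] only at [t = - z_0(x)]. *)
- move=> Z cZ OZ x x0; apply: (zclosed_line (y := origin) cZ x0 (a := - x 0 0)) => t ta.
  have l0 : (x + t *: origin) 0 0 != 0.
    by rewrite mxE [X in _ + X]mxE vecE0 mulr1 addrC addr_eq0.
  have xl0 : x + t *: origin != 0 by apply: contra l0 => /eqP ->; rewrite mxE.
  by split=> //; apply: OZ => //; apply/orbit_originE.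
- move=> g [c [_]]; rewrite heis_rep_origin vecZ => /vec_inj[c1 E2 E1].
  have g1 : g.1 = 0 by rewrite -[g.1]trmxK E1 scaler0 trmx0.
  move: E2; rewrite g1 /bilin !mul0mx mxE mulr0 add0r mulr0 => g2.
  by rewrite /heis_one [g]surjective_pairing g1 g2.
Qed.

Lemma T_fixes_boundary_origin S : T_fixes_boundary (heis_rep Om S) origin.
Proof.
move=> x x0 /orbit_originE/negP/negPn/eqP x00; exists 1; split; first exact: oner_neq0.
by rewrite heis_rep_centre // x00 mulr0 scale0r addr0 scale1r.
Qed.

(** The points [vT + t o] with [t] nonzero lie in the central orbit and degenerate to [vT] at
    [t = 0]; the orbit itself avoids [z_0 = 0]. *)
Lemma vT_boundary S (o : V) : o 0 0 != 0 ->
  boundary_of_I_orbit (heis_rep Om S) o vT.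
Proof.
move=> o0; split; [exact: vT_neq0|split].
  split; first exact: vT_neq0.
  move=> Z cZ OZ; apply: (zclosed_line (y := o) cZ vT_neq0 (a := 0)) => t t0.
  have l0 : vT + t *: o != 0.
    apply: contra (mulf_neq0 t0 o0) => /eqP/colP/(_ 0).
    by rewrite mxE vecE0 add0r [LHS]mxE [RHS]mxE => ->.
  split=> //; apply: OZ => //; split=> //.
  (* [vT + t o = t (o + t^-1 vT)], and the central element of parameter [s] adds [s z_0(o) vT] to
     [o]. *)
  exists (0, (t * o 0 0)^-1); split=> //; exists t; split=> //.
  rewrite heis_rep_centre //= scalerDr scalerA addrC.
  by rewrite invfM -mulrA mulVf // mulr1 divff // scale1r.
case=> _ [g [gI [c [c0]]]]; rewrite heis_rep_centre // => /colP/(_ 0).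
rewrite vecE0 mxE [X in _ * X]mxE [X in _ + X]mxE vecE0 mulr0 addr0 => /esym/eqP.
by rewrite mulf_eq0 (negPf c0) (negPf o0).
Qed.

(* The closure lies in the span of o and vT, which is cut out by linear forms. *)
Lemma boundary_vT S (o hv : V) : o 0 0 != 0 ->
  boundary_of_I_orbit (heis_rep Om S) o hv -> exists c, hv = c *: vT.
Proof.
move=> o0 [hv0 [[_ cl] nI]].
have [a [b [y Ehv]]] := vec_surj hv; have [a' [b' [y' Eo]]] := vec_surj o.
move: o0; rewrite Eo vecE0 => a0.
pose idx (k : 'I_(2 * n)) : 'I_N := rshift 1 (rshift 1 k).
pose X (k : 'I_N) := @mpoly.mpolyX N C (mpoly.mnm1 k).
(* These forms vanish on [o] and [vT]; as [z_0(o)] is nonzero, their common zeros are exactly the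
   span of the two. *)
pose L k := o 0 0 *: X (idx k) - o (idx k) 0 *: X 0.
have mevL k x : mev (L k) x = o 0 0 * x (idx k) 0 - o (idx k) 0 * x 0 0.
  by rewrite /mev mpoly.mevalB !mpoly.mevalZ !mpoly.mevalXU.
have Hhv k : mev (L k) hv = 0.
  apply: (cl (fun x => forall k, mev (L k) x = 0)).
    exists (fun p => exists k, p = L k); split=> [_ [j ->]|x x0].
      exists 1%N; rewrite homogE.
      by apply: rpredB; apply: rpredZ; apply: homog1X.
    by split=> [H _ [j ->] //|H j]; apply: H; exists j.
  move=> x _ [_ [g [gI [c [_ ->]]]]] j.
  have E i : vT i 0 = 0 -> (c *: (o + (g.2 * o 0 0) *: vT)) i 0 = c * o i 0.
    by move=> Ti; rewrite mxE [X in _ * X]mxE [X in _ + X]mxE Ti mulr0 addr0.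
  rewrite heis_rep_centre // mevL !E ?vecE0 ?vecE2 ?mxE //.
  by ring.
have Ey : a' *: y = a *: y'.
  apply/colP => k; rewrite !mxE; have := Hhv k.
  rewrite mevL Ehv Eo !vecE0 !vecE2 => /eqP; rewrite subr_eq0 => /eqP ->.
  by rewrite mulrC.
(* If [z_0(hv) = 0], the relation [Ey] leaves only the [z_T] coordinate. *)
have [a00|an0] := eqVneq a 0.
  exists b; rewrite Ehv /vT vecZ mulr0 mulr1 scaler0 a00; congr vec.
  by apply/eqP; move/eqP: Ey; rewrite a00 scale0r scaler_eq0 (negPf a0).
(* Otherwise [hv] would lie in the central orbit: after rescaling by [a / a'], the parameter is
   solved from the [z_T] coordinate. *)
case: nI; split=> //; exists (0, (b * a' / a - b') / a').
split=> //; exists (a / a'); split; first by rewrite mulf_neq0 ?invr_eq0.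
rewrite heis_rep_centre // Ehv Eo vecE0 /vT /= vecZ vecD vecZ.
rewrite !mulr0 !addr0 scaler0 addr0.
congr vec.
- by rewrite divfK.
- by field; rewrite an0 a0.
- by rewrite mulrC -scalerA -Ey scalerA mulVf // scale1r.
Qed.

(** The linear projection from [v], which forgets [z_T]. *)
Definition pi_mx : 'M[C]_(1 + 2 * n, 1 + (1 + 2 * n)) :=
  block_mx 1%:M 0 0 (row_mx 0 1%:M).

Lemma pi_mx_vec a b y : pi_mx *m vec a b y = col_mx (a%:M : 'M_1) y.
Proof.
rewrite /pi_mx /vec mul_block_col mul_row_col.
by rewrite !(mul0mx, mul1mx, addr0, add0r).
Qed.

Lemma rank_pi_mx : \rank pi_mx = (2 * n).+1.
Proof.
apply/eqP; rewrite -[_ == _]/(row_free pi_mx); apply/row_freeP.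
exists pi_mx^T; rewrite /pi_mx tr_block_mx tr_row_mx mulmx_block mul_row_col.
by rewrite !trmx0 !trmx1 !(mul0mx, mulmx0, mul1mx, addr0, add0r) -scalar_mx_block.
Qed.

Lemma taut_mxE (w : 'rV[C]_(2 * n)) :
  taut_mx w = block_mx (1%:M : 'M_1) 0 w^T 1%:M :> 'M_(1 + 2 * n).
Proof.
apply/matrixP => i j; rewrite -(splitK i) -(splitK j).
have r0 k : rshift 1 k = lift ord0 k :> 'I_(2 * n).+1 by apply: val_inj.
have l0 k : lshift (2 * n) k = ord0 :> 'I_(1 + 2 * n).
  by apply: val_inj; rewrite (ord1 k).
case: (split i) => k; case: (split j) => l /=.
- by rewrite block_mxEul !l0 !mxE unlift_none !ord1 /= addr0.
- by rewrite block_mxEur l0 r0 !mxE addr0.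
- by rewrite block_mxEdl l0 r0 !mxE liftK /= add0r ord1.
- by rewrite block_mxEdr !r0 !mxE addr0 (inj_eq lift_inj).
Qed.

(** The form and [t] enter only the [z_T] coordinate, which the projection forgets, so every [S]
    induces the same action. *)
Lemma induced_tautological_vT S c : induced_tautological (heis_rep Om S) (c *: vT).
Proof.
exists 1%:M, pi_mx; split; [exact: unitmx1|exact: rank_pi_mx| |].
  by rewrite -scalemxAr pi_mx_vec raddf0 col_mx0 scaler0.
move=> w t x _; exists 1; split; first exact: oner_neq0.
have [a [b [y ->]]] := vec_surj x.
rewrite mulmx1 heis_rep_vec !pi_mx_vec taut_mxE (@mul_block_col _ 1 _ 1) scale1r.
by rewrite !(mul0mx, mul1mx, addr0) mul_mx_scalar addrC.
Qed.

Lemma heis_rep_special S : S^T = S -> special_Hstructure Om (heis_rep Om S).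
Proof.
move=> sS; split; first exact: heis_rep_alg.
exists origin; split; [exact: open_orbit_origin|exact: T_fixes_boundary_origin|].
move=> o /orbit_originE o0; split; first by exists vT; apply: vT_boundary.
by move=> hv /(boundary_vT o0)[c ->]; apply: induced_tautological_vT.
Qed.

End SpecialStructure.

(** * A determinant invariant of equivalence *)

Section Inequivalence.
Variables (R : realType) (n : nat) (Om : 'M[R[i]]_(2 * n)).
Local Notation C := R[i].
Local Notation N := (2 * n).+2.
Implicit Types (S B P : 'M[C]_(2 * n)).

Lemma bilin_row B P k l :
  (P *m B *m P^T) k l = bilin B (row k P) (row l P).
Proof.
rewrite /bilin -row_mul [LHS]mxE [RHS]mxE.
by apply: eq_bigr => j _; rewrite !mxE.
Qed.

Lemma bilin_delta B k l : bilin B (delta_mx 0 k) (delta_mx 0 l) = B k l.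
Proof. by rewrite /bilin -rowE trmx_delta -colE !mxE. Qed.

(** The skew part is [Om / 2], and an invertible matrix of positive size is not zero. *)
Lemma heis_form_neq0 S : (0 < n)%N -> nondeg_skew Om -> S^T = S ->
  heis_form Om S != 0.
Proof.
move=> n0 [skOm uOm] sS; apply/eqP => B0.
have Om0 : Om = 0.
  have : heis_form Om S - (heis_form Om S)^T = 0 by rewrite B0 trmx0 subr0.
  rewrite /heis_form linearD linearZ /= sS skOm scalerN opprD opprK.
  rewrite addrACA subrr add0r.
  by rewrite -scalerDl (_ : 2%:R^-1 + 2%:R^-1 = 1) ?scale1r //; field.
have n20 : (0 < 2 * n)%N by rewrite muln_gt0.
have /matrixP/(_ (Ordinal n20) (Ordinal n20)) := mulmxV uOm.
by rewrite Om0 mul0mx !mxE eqxx => /esym/eqP; rewrite oner_eq0.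
Qed.

(* The linear map intertwines the two representations exactly, not only up to
   a scalar, because both are unipotent: compare traces. *)
Lemma equivalent_intertwines S1 S2 :
  equivalent Om (heis_rep Om S1) (heis_rep Om S2) ->
  exists (phi : heis R n -> heis R n) (M : 'M[C]_N),
    M \in unitmx /\ forall g, M *m heis_rep Om S1 g = heis_rep Om S2 (phi g) *m M.
Proof.
case=> phi [F [_ aut H]]; have [M uM EM] := proj_automorphism_linear aut.
exists phi, M; split=> // g.
have tr_rep S h : \tr (heis_rep Om S h) = N%:R.
  by rewrite /heis_rep mxtraceD mxtrace_nil_mx mxtrace1 addr0.
have [||c Ec] := @proj_eq_mx_scalar _ _ (M *m heis_rep Om S1 g)
    (heis_rep Om S2 (phi g) *m M).
- by rewrite unitmx_mul uM andbT unitmxE det_unipotent unitr1.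
- by move=> x x0; rewrite -!mulmxA -!EM; apply: H.
suff c1 : c = 1 by rewrite Ec c1 scale1r.
have Etr : \tr (heis_rep Om S1 g) = c * \tr (heis_rep Om S2 (phi g)).
  rewrite -{1}[heis_rep Om S1 g](mulKmx uM) Ec -scalemxAr mxtraceZ.
  by rewrite mxtrace_mulC (mulmxK uM).
have N0 : N%:R != 0 :> C by rewrite pnatr_eq0.
move: Etr; rewrite [X in X = _](tr_rep S1 g) => Etr.
rewrite [X in _ = _ * X](tr_rep S2 (phi g)) in Etr.
by move/(congr1 (fun x => x / N%:R)): Etr; rewrite (mulfK N0) divff.
Qed.

(** Conjugation by [M] carries [N1 w1 *m N1 w2] to [N2 w1 *m N2 w2], both multiples of [E];
    comparing coefficients makes the two forms proportional along [f]. *)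
Lemma equivalent_congruent S1 S2 :
  (0 < n)%N -> nondeg_skew Om -> S1^T = S1 ->
  equivalent Om (heis_rep Om S1) (heis_rep Om S2) ->
  exists2 c, c != 0 &
    exists P, P *m heis_form Om S2 *m P^T = c *: heis_form Om S1.
Proof.
move=> n0 ndOm sS1 /equivalent_intertwines[phi [M [uM HM]]].
pose E : 'M[C]_N := central_mx _ (2 * n).
pose f w := (phi (w, 0)).1.
pose N1 w : 'M[C]_N :=
  nil_mx (heis_form Om S1) w (2%:R^-1 * bilin S1 w w + 0).
pose N2 w : 'M[C]_N :=
  nil_mx (heis_form Om S2) (f w)
    (2%:R^-1 * bilin S2 (f w) (f w) + (phi (w, 0)).2).
have MN w : M *m N1 w = N2 w *m M.
  by have := HM (w, 0); rewrite /heis_rep mulmxDr mulmxDl mulmx1 mul1mx => /addrI.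
have N1M w1 w2 : N1 w1 *m N1 w2 = bilin (heis_form Om S1) w1 w2 *: E.
  exact: nil_mxM.
have N2M w1 w2 : N2 w1 *m N2 w2 = bilin (heis_form Om S2) (f w1) (f w2) *: E.
  exact: nil_mxM.
have E0 : E != 0 by exact: central_mx_neq0.
clearbody E N1 N2.
have key w1 w2 : bilin (heis_form Om S1) w1 w2 *: (M *m E)
    = bilin (heis_form Om S2) (f w1) (f w2) *: (E *m M).
  by rewrite scalemxAr -N1M mulmxA MN -mulmxA MN mulmxA N2M -scalemxAl.
have EM0 : E *m M != 0.
  by apply: contraNneq E0 => EM0; rewrite -[E](mulmxK uM) EM0 mul0mx.
have ME0 : M *m E != 0.
  by apply: contraNneq E0 => ME0; rewrite -[E](mulKmx uM) ME0 mulmx0.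
(* One nonzero entry of the first form fixes the ratio [c] of [M *m E] to [E *m M]. *)
have /matrix0Pn[k [l B0]] := heis_form_neq0 n0 ndOm sS1.
pose e j : 'rV[C]_(2 * n) := delta_mx 0 j.
pose c := bilin (heis_form Om S2) (f (e k)) (f (e l)) / heis_form Om S1 k l.
have EME : M *m E = c *: (E *m M).
  by rewrite /c mulrC -scalerA -key bilin_delta scalerA mulVf // scale1r.
have c0 : c != 0 by apply: contraNneq ME0 => c0; rewrite EME c0 scale0r.
(* The rows of [P] are the values of [f] at the basis vectors, so the congruence is a Gram matrix
   whose entries [key] compares. *)
exists c => //; exists (\matrix_j f (e j)); apply/matrixP => p q.
rewrite bilin_row !rowK [RHS]mxE -[X in _ * X]bilin_delta.
have := key (e p) (e q); rewrite EME scalerA => /eqP.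
rewrite -subr_eq0 -scalerBl scaler_eq0 (negPf EM0) orbF subr_eq0 => /eqP <-.
by rewrite mulrC.
Qed.

(* Separating symmetric and skew parts, the congruence carries the pair
   (S2, Om) to c (S1, Om), so det S / det Om is an invariant. *)
Lemma equivalent_det S1 S2 :
  (0 < n)%N -> nondeg_skew Om -> S1^T = S1 -> S2^T = S2 ->
  equivalent Om (heis_rep Om S1) (heis_rep Om S2) -> \det S1 = \det S2.
Proof.
move=> n0 ndOm sS1 sS2 /(equivalent_congruent n0 ndOm sS1)[c c0 [P EP]].
have [skOm uOm] := ndOm.
have trform S : S^T = S -> (heis_form Om S)^T = S - 2%:R^-1 *: Om.
  by move=> sS; rewrite /heis_form linearD linearZ /= sS skOm scalerN.
(* Transposing the congruence reverses the sign of the skew part. *)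
have EPT : P *m (S2 - 2%:R^-1 *: Om) *m P^T = c *: (S1 - 2%:R^-1 *: Om).
  by rewrite -!trform // -linearZ /= -EP !trmx_mul trmxK mulmxA.
have half2 : 2%:R^-1 + 2%:R^-1 = 1 :> C by field.
have ES : P *m S2 *m P^T = c *: S1.
  have D S : S = 2%:R^-1 *: (heis_form Om S + (S - 2%:R^-1 *: Om)).
    by rewrite /heis_form addrACA subrr addr0 scalerDr -scalerDl half2 scale1r.
  rewrite [S2]D [S1]D -scalemxAr -scalemxAl mulmxDr mulmxDl EP EPT.
  by rewrite -scalerDr !scalerA mulrC.
have EOm : P *m Om *m P^T = c *: Om.
  have D S : Om = heis_form Om S - (S - 2%:R^-1 *: Om).
    by rewrite /heis_form opprB addrC addrA subrK -scalerDl half2 scale1r.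
  by rewrite {1}[Om](D S2) mulmxBr mulmxBl EP EPT -scalerBr -D.
(* The relation for [Om] gives [(det P)^2 = c^(2n)], a nonzero factor that cancels in the relation
   for [S]. *)
have := congr1 determinant EOm; rewrite !det_mulmx det_tr detZ.
move: uOm; rewrite unitmxE unitfE => dOm0; rewrite mulrAC => /(mulIf dOm0) dP.
have := congr1 determinant ES; rewrite !det_mulmx det_tr detZ mulrAC dP.
by move=> /(mulfI (expf_neq0 _ c0)).
Qed.

End Inequivalence.

Theorem theorem3p12 (R : realType) (n : nat) (Om : 'M[R[i]]_(2 * n)) :
  (1 <= n)%N -> nondeg_skew Om ->
  exists rho : nat -> heis R n -> 'M[R[i]]_((2 * n).+2),
    (forall k, special_Hstructure Om (rho k)) /\
    (forall k l, k <> l -> ~ equivalent Om (rho k) (rho l)).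
Proof.
move=> n0 ndOm; exists (fun k => heis_rep Om k%:R%:M); split=> [k|k l kl eq_kl].
  exact/heis_rep_special/tr_scalar_mx.
have := equivalent_det n0 ndOm (tr_scalar_mx _ _) (tr_scalar_mx _ _) eq_kl.
(* [det (k 1) = k^(2n)] determines the natural number [k], since [2n > 0]. *)
rewrite !det_scalar -!natrX => /eqP; rewrite eqr_nat eqn_exp2r ?muln_gt0 //.
by move/eqP.
Qed.
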